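(* Let $G=([n],E)$ be a graph, let $M_G$ be its Tutte symmetric matrix (the infinite matrix indexed by positive integers defined in the context), and let $\vec v,\vec w$ be the infinite row vectors $\vec v=[\,e_1\ \ 2e_2\ \ 3e_3\ \cdots]$ and $\vec w=[\,1\ \ 0\ \ 0\ \cdots]$. Then the Tutte symmetric function of $G$ is $$XB_G(\boldsymbol x;t)=\vec v\,M_G\,\vec w^{\,T}.$$
   Context: $[n]=\{1,\dots,n\}$, $\mathbb P=\{1,2,3,\dots\}$, $t$ is an indeterminate. A graph is $G=([n],E)$ with $n\ge 1$ and $E$ a set of 2-element subsets of $[n]$. $P_j$ is the path on $[j]$ with edges $\{i,i+1\}$. For $G=([n],E)$ and $H=([n'],E')$, the sum $G+H=([n+n'-1],E\cup\{\{i+n-1,j+n-1\}:\{i,j\}\in E'\})$ glues vertex $n$ of $G$ to vertex $1$ of $H$. The Tutte symmetric function of $G=([n],E)$ is $XB_G(\boldsymbol x;t)=\sum_{\kappa:[n]\to\mathbb P}(1+t)^{e(\kappa)}x_{\kappa(1)}\cdots x_{\kappa(n)}$, where $e(\kappa)$ is the number of edges $\{u,v\}$ with $\kappa(u)=\kappa(v)$. $e_n=\sum_{i_1<\cdots<i_n}x_{i_1}\cdots x_{i_n}$, $e_0=1$, and $e_\lambda=e_{\lambda_1}\cdots e_{\lambda_\ell}$ for a partition $\lambda$. A composition is a finite sequence $\alpha=(\alpha_1,\dots,\alpha_\ell)$ of positive integers; $\ell=\ell(\alpha)$ is its length, $\alpha_\ell$ its last part, its size is the sum of its parts; $\mathrm{sort}(\alpha)$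 is the partition obtained by sorting. A component triple of $G$ is $\mathcal C=(C,\alpha,r)$ where $C$ is a connected (not necessarily induced) subgraph of $G$, $\alpha$ is a composition of size $|C|$ (number of vertices), and $1\le r\le\alpha_1$ is an integer. A subgraph triple $\mathcal S$ of $G$ is a collection of component triples $(C_1,\alpha^{(1)},r_1),\dots,(C_m,\alpha^{(m)},r_m)$ such that the disjoint union $C_1\sqcup\cdots\sqcup C_m$ is a spanning subgraph of $G$; the order of listing is immaterial. $\mathrm{ST}(G)$ is the set of subgraph triples. $\mathrm{type}(\mathcal S)=\mathrm{sort}(\alpha^{(1)}\cdots\alpha^{(m)})$ (concatenate and sort); $\mathrm{sign}(\mathcal S)=(-1)^{N-\ell(\mathrm{type}(\mathcal S))}$ with $N$ the number of vertices of the graph; $E(\mathcal S)$ is the total number of edges in $C_1,\dots,C_m$; the reduced type $\mathrm{type}'(\mathcal S)$ is $\mathrm{type}(\mathcal S)$ with one instance of $\alpha_1$ removed, where $\alpha$ is the composition of the component containing vertex $1$. For $G=([n],E)$ and $i,j\ge1$, $\mathrm{ST}^{(i)}(G+P_j)$ is the set of $\mathcal S\in\mathrm{ST}(G+P_j)$ such that, with $(C,\alpha,r)$ the component triple with $1\in C$ and $(C',\alpha',r')$ the component triple with $n\in C'$ (possibly the same), one has $\alpha_1=i$, $r=1$, $\{n,n+1,\dots,n+j-1\}\subseteq C'$, and the last part satisfies $\alpha'_\ell\ge j$. The Tutte symmetric matrix $M_G$ has entries $$(M_G)_{i,j}=\sum_{\mathcal S\in\mathrm{ST}^{(i)}(G+P_j)}\mathrm{sign}(\mathcal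 S)\,(-1)^{1-j}\,t^{E(\mathcal S)+1-j}\,e_{\mathrm{type}'(\mathcal S)},\qquad i,j\ge1.$$ Each column of $M_G$ has finitely many nonzero entries (the entry is $0$ when $i\ge n+j$), so the products are well defined. *)

(* Defs.v *)
From HB Require Import structures.
From mathcomp Require Import all_boot all_algebra finmap monalg.
From mathcomp Require Import boolp classical_sets functions cardinality fsbigop.

Set Implicit Arguments.
Unset Strict Implicit.
Unset Printing Implicit Defensive.

Import GRing.Theory.
Local Open Scope ring_scope.

Local Notation "1" := mone : monom_scope.
Local Notation "x * y" := (mmul x y) : monom_scope.
Local Notation "'U_(' i )" := (ucm i) : monom_scope.

(* Formal power series over R in commuting variables indexed by an arbitrary
   (possibly infinite) choiceType I, as coefficient functions on monomials. *)

Record fps (I : choiceType) (R : Type) := Fps { fpscoef :> {cmonom I} -> R }.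

Section PowerSeries.
Context (I : choiceType) (R : comNzRingType).
Implicit Types (f g h : fps I R) (m : {cmonom I}).

Lemma fpsP f g : f = g <-> (forall m, f m = g m).
Proof.
split=> [-> //|]; case: f g => [f] [g] /= fg.
by congr Fps; apply/funext.
Qed.

HB.instance Definition _ := gen_eqMixin (fps I R).
HB.instance Definition _ := gen_choiceMixin (fps I R).

Definition fps_zero : fps I R := Fps (fun=> 0).
Definition fps_opp f : fps I R := Fps (fun m => - f m).
Definition fps_add f g : fps I R := Fps (fun m => f m + g m).

Fact fps_addA : associative fps_add.
Proof. by move=> f g h; apply/fpsP => m /=; rewrite addrA. Qed.
Fact fps_addC : commutative fps_add.
Proof. by move=> f g; apply/fpsP => m /=; rewrite addrC. Qed.
Fact fps_add0 : left_id fps_zero fps_add.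
Proof. by move=> f; apply/fpsP => m /=; rewrite add0r. Qed.
Fact fps_addN : left_inverse fps_zero fps_opp fps_add.
Proof. by move=> f; apply/fpsP => m /=; rewrite addNr. Qed.

HB.instance Definition _ :=
  GRing.isZmodule.Build (fps I R) fps_addA fps_addC fps_add0 fps_addN.

Definition fps_one : fps I R := Fps (fun m => (m == 1%M)%:R).

(* Here and below \sum_(i \in A) F i, with A a classical set, is the sum of a
   finitely supported family (it is 0 by convention for infinite support). *)
Definition fps_mul f g : fps I R :=
  Fps (fun m => \sum_(p \in [set p : {cmonom I} * {cmonom I}
                              | (p.1 * p.2)%M = m]%classic) f p.1 * g p.2).

(* An explicit enumeration of the factorisations of a monomial. *)
Definition mfact m : seq ({cmonom I} * {cmonom I}) :=
  let G (k : {ffun finsupp m -> 'I_(mdeg m).+1}) : {cmonom I} :=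
    mkcmonom [fsfun i : finsupp m => nat_of_ord (k i) | 0%N] in
  [seq p <- undup [seq (G k, divcm m (G k)) | k : _] | (p.1 * p.2)%M == m].

Lemma mfact_uniq m : uniq (mfact m).
Proof. exact/filter_uniq/undup_uniq. Qed.

Lemma mem_mfact m p : (p \in mfact m) = ((p.1 * p.2)%M == m).
Proof.
rewrite mem_filter; case: eqP => //= pm; rewrite mem_undup.
have coefM i : m i = (p.1 i + p.2 i)%N by rewrite -pm cmM.
have ltm i : (p.1 i < (mdeg m).+1)%N.
  by rewrite ltnS -pm mdegM; apply: leq_trans (leq_addr _ _);
    rewrite mdegE; case: (finsuppP p.1 i) => // ip;
    rewrite (big_fsetD1 i) //= leq_addr.
apply/mapP; exists [ffun i : finsupp m => Ordinal (ltm (val i))].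
  by rewrite mem_enum.
set a := mkcmonom _.
have aE : a = p.1.
  apply/eqP/cmP => i; rewrite cmE /= fsfun_ffun.
  case: insubP => [u _ <-|]; first by rewrite /= ffunE.
  by rewrite -cmE_eq0 coefM addn_eq0 => /andP[/eqP-> _].
rewrite aE; case: p pm coefM {ltm a aE} => a b /= pm coefM; congr pair.
by apply/eqP/cmP => i; rewrite divcmE coefM addKn.
Qed.

Lemma fps_mulE f g m : fps_mul f g m = \sum_(p <- mfact m) f p.1 * g p.2.
Proof.
rewrite (fsbig_seq _ _ (mfact_uniq m)) /=; apply: eq_fsbigl.
by apply/seteqP; split=> p /=; rewrite mem_mfact => /eqP.
Qed.

Fact fps_mulC : commutative fps_mul.
Proof.
move=> f g; apply/fpsP => m; rewrite !fps_mulE.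
pose s (p : {cmonom I} * {cmonom I}) := (p.2, p.1).
rewrite (perm_big [seq s p | p <- mfact m]) /=; last first.
  have sI : injective s by move=> [a b] [c d] [-> ->].
  apply: uniq_perm; rewrite ?map_inj_uniq ?mfact_uniq // => -[a b].
  rewrite mem_mfact; apply/eqP/mapP => /= [ab|[[c d]]].
    by exists (b, a) => //; rewrite mem_mfact /= mulmC ab.
  by rewrite mem_mfact /= => /eqP <- [-> ->]; rewrite mulmC.
by rewrite big_map; apply: eq_bigr => p _; rewrite mulrC.
Qed.

Fact fps_mul1 : left_id fps_one fps_mul.
Proof.
move=> f; apply/fpsP => m; rewrite fps_mulE.
rewrite (bigD1_seq (1%M, m)) ?mfact_uniq ?mem_mfact ?mul1m //=.
rewrite eqxx mul1r big_seq_cond big1 ?addr0 // => -[a b].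
rewrite mem_mfact /= => /andP[/eqP <-]; have [->|] := eqVneq a 1%M.
  by rewrite mul1m eqxx.
by rewrite mul0r.
Qed.

Fact fps_mulD : left_distributive fps_mul +%R.
Proof.
move=> f g h; apply/fpsP => m.
change (fps_mul (f + g) h m = fps_mul f h m + fps_mul g h m).
by rewrite !fps_mulE -big_split; apply: eq_bigr => p _ /=; rewrite mulrDl.
Qed.

Fact fps_mulA : associative fps_mul.
Proof.
move=> f g h; apply/fpsP => m; rewrite !fps_mulE.
pose T := ({cmonom I} * {cmonom I} * {cmonom I})%type.
pose F (x : T) := f x.1.1 * g x.1.2 * h x.2.
transitivity (\sum_(x <- [seq ((p.1, q.1), q.2) : T
                         | p <- mfact m, q <- mfact p.2]) F x).
  rewrite big_allpairs_dep; apply: eq_bigr => p _.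
  by rewrite fps_mulE mulr_sumr; apply: eq_bigr => q _; rewrite mulrA.
transitivity (\sum_(x <- [seq (q, p.2) : T
                         | p <- mfact m, q <- mfact p.1]) F x); last first.
  rewrite big_allpairs_dep; apply: eq_bigr => p _.
  by rewrite fps_mulE mulr_suml.
apply: perm_big; apply: uniq_perm.
- apply: allpairs_uniq_dep => [|p _|]; rewrite ?mfact_uniq //.
  move=> [p q] [p' q'] /allpairsPdep[x [y [_ xy [-> ->]]]].
  move=> /allpairsPdep[x' [y' [_ xy' [-> ->]]]] [].
  case: x y x' y' xy xy' => [a b] [c d] [a' b'] [c' d'] /=.
  by rewrite !mem_mfact /= => /eqP <- /eqP <- -> -> ->.
- apply: allpairs_uniq_dep => [|p _|]; rewrite ?mfact_uniq //.
  move=> [p q] [p' q'] /allpairsPdep[x [y [_ xy [-> ->]]]].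
  move=> /allpairsPdep[x' [y' [_ xy' [-> ->]]]] [].
  case: x y x' y' xy xy' => [a b] [c d] [a' b'] [c' d'] /=.
  by rewrite !mem_mfact /= => /eqP <- /eqP <- [-> ->] ->.
- move=> [[a b] c]; apply/allpairsPdep/allpairsPdep.
    move=> [[u v] [[w z] []]]; rewrite !mem_mfact /= => /eqP <- /eqP <-.
    by case=> -> -> ->; exists ((u * w)%M, z), (u, w);
      rewrite !mem_mfact /= mulmA !eqxx.
  move=> [[u v] [[w z] []]]; rewrite !mem_mfact /= => /eqP <- /eqP <-.
  by case=> -> -> ->; exists (w, (z * v)%M), (z, v);
    rewrite !mem_mfact /= mulmA !eqxx.
Qed.

Fact fps_one_neq0 : fps_one != 0.
Proof.
by apply/eqP => /fpsP/(_ 1%M) /=; rewrite eqxx; apply/eqP/oner_neq0.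
Qed.

HB.instance Definition _ := GRing.Zmodule_isComNzRing.Build (fps I R)
  fps_mulA fps_mulC fps_mul1 fps_mulD fps_one_neq0.

Definition fps_scale (c : R) f : fps I R := Fps (fun m => c * f m).

Fact fps_scaleA c d f : fps_scale c (fps_scale d f) = fps_scale (c * d) f.
Proof. by apply/fpsP => m /=; rewrite mulrA. Qed.
Fact fps_scale1 : left_id 1 fps_scale.
Proof. by move=> f; apply/fpsP => m /=; rewrite mul1r. Qed.
Fact fps_scaleDr : right_distributive fps_scale +%R.
Proof. by move=> c f g; apply/fpsP => m /=; rewrite mulrDr. Qed.
Fact fps_scaleDl f : {morph fps_scale^~ f : c d / c + d}.
Proof. by move=> c d; apply/fpsP => m /=; rewrite mulrDl. Qed.

HB.instance Definition _ := GRing.Zmodule_isLmodule.Build R (fps I R)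
  fps_scaleA fps_scale1 fps_scaleDr fps_scaleDl.

Fact fps_scaleAl (c : R) f g : c *: (f * g) = (c *: f) * g.
Proof.
apply/fpsP => m.
change (c * fps_mul f g m = fps_mul (c *: f) g m).
rewrite !fps_mulE mulr_sumr.
by apply: eq_bigr => p _; rewrite mulrA.
Qed.

HB.instance Definition _ :=
  GRing.Lmodule_isLalgebra.Build R (fps I R) fps_scaleAl.
HB.instance Definition _ := GRing.Lalgebra_isComAlgebra.Build R (fps I R).

Definition fps_var (i : I) : fps I R := Fps (fun m => (m == U_(i)%M)%:R).

(* The sum of a family of power series in which each monomial has a nonzero
   coefficient in finitely many members only. *)
Definition fps_sum (T : choiceType) (A : set T) (F : T -> fps I R) : fps I R :=
  Fps (fun m => \sum_(i \in A) F i m).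

End PowerSeries.

(* Graphs on [n]; the vertex v : 'I_n is the one labelled v + 1 in [n]. *)

Record graph (n : nat) := Graph {
  gedges : {set {set 'I_n}};
  _ : [forall e in gedges, #|e| == 2]
}.

Lemma card_gedge n (G : graph n) e : e \in gedges G -> #|e| = 2.
Proof. by case: G => E /= /forall_inP EP /EP/eqP. Qed.

Definition path_edges (n : nat) : {set {set 'I_n}} :=
  [set e : {set 'I_n} | [exists u : 'I_n, exists v : 'I_n,
    (v == u.+1 :> nat) && (e == [set u; v])]].

Fact path_edgesP n : [forall e in path_edges n, #|e| == 2].
Proof.
apply/forall_inP => e; rewrite inE.
move=> /existsP[u /existsP[v /andP[/eqP uv /eqP->]]].
by rewrite cards2 -val_eqE /= uv neq_ltn ltnSn.
Qed.

Definition path_graph (n : nat) : graph n := Graph (path_edgesP n).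

Section GraphSum.
Context (m k : nat).

Definition glue_left (v : 'I_m.+1) : 'I_(m + k).+1 := inord v.
Definition glue_right (v : 'I_k.+1) : 'I_(m + k).+1 := inord (m + v).

Fact glue_left_inj : injective glue_left.
Proof.
move=> u v /(congr1 (@nat_of_ord _)); rewrite !inordK ?ltnS.
- exact: val_inj.
- by rewrite (leq_trans (leq_ord v)) ?leq_addr.
- by rewrite (leq_trans (leq_ord u)) ?leq_addr.
Qed.

Fact glue_right_inj : injective glue_right.
Proof.
move=> u v /(congr1 (@nat_of_ord _)); rewrite !inordK ?ltnS ?leq_add2l ?leq_ord//.
by move/addnI/val_inj.
Qed.

Context (G : graph m.+1) (H : graph k.+1).

Definition sum_edges : {set {set 'I_(m + k).+1}} :=
  [set glue_left @: (e : {set 'I_m.+1}) | e in gedges G] :|: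
  [set glue_right @: (e : {set 'I_k.+1}) | e in gedges H].

Fact sum_edgesP : [forall e in sum_edges, #|e| == 2].
Proof.
apply/forall_inP => e /setUP[] /imsetP[f /card_gedge fE ->].
  by rewrite card_imset ?fE //; exact: glue_left_inj.
by rewrite card_imset ?fE //; exact: glue_right_inj.
Qed.

Definition graph_sum : graph (m + k).+1 := Graph sum_edgesP.

End GraphSum.

(* Symmetric functions are power series over Z[t], t = 'X, in variables indexed
   by nat: the variable of index c is x_{c+1}, so that a map to the positive
   integers is represented by its pointwise predecessor. *)

Notation symfun := (fps nat {poly int}).
Notation "''x_' c" := (@fps_var nat {poly int} c)
  (at level 8, c at level 2, format "''x_' c") : ring_scope.

(* Indices i_1 < ... < i_k are the elements of a k-element set. *)
Definition elem_sym (k : nat) : symfun :=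
  fps_sum [set A : {fset nat} | #|` A| = k]%classic
    (fun A => \prod_(c <- A) 'x_c).

Definition elem_sym_seq (la : seq nat) : symfun := \prod_(k <- la) elem_sym k.

Definition mono_edges n (G : graph n) (kappa : {ffun 'I_n -> nat}) : nat :=
  #|[set e in gedges G | [forall u in e, forall v in e, kappa u == kappa v]]|.

Definition tutte_sym n (G : graph n) : symfun :=
  fps_sum [set: {ffun 'I_n -> nat}]%classic
    (fun kappa => (1 + 'X) ^+ mono_edges G kappa *: \prod_(v < n) 'x_(kappa v)).

Definition is_composition (al : seq nat) (s : nat) : bool :=
  all (fun k => 0 < k)%N al && (sumn al == s).

Definition subgraph_connected n (V : {set 'I_n}) (F : {set {set 'I_n}}) : bool :=
  (V != finset.set0) &&
  [forall u in V, forall v in V, connect (fun x y => [set x; y] \in F) u v].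

(* Raw component triples ((V, F), alpha, r) on n vertices.  A composition of
   size at most n has at most n parts, each at most n; bounding alpha and r in
   this way makes the type finite. *)
Record ctriple (n : nat) := CTriple {
  cvert : {set 'I_n};
  cedges : {set {set 'I_n}};
  ccomp_ord : n.-bseq 'I_n.+1;
  cmark : 'I_n.+1
}.

Section ComponentTripleFinite.
Context (n : nat).

Definition ctriple_tuple (c : ctriple n) :=
  (cvert c, cedges c, ccomp_ord c, cmark c).
Definition tuple_ctriple x : ctriple n := CTriple x.1.1.1 x.1.1.2 x.1.2 x.2.

Fact ctriple_tupleK : cancel ctriple_tuple tuple_ctriple.
Proof. by case. Qed.

HB.instance Definition _ := Finite.copy (ctriple n) (can_type ctriple_tupleK).

End ComponentTripleFinite.

Definition ccomp n (c : ctriple n) : seq nat :=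
  [seq nat_of_ord k | k <- ccomp_ord c].

Definition cfirst n (c : ctriple n) : nat := head 0%N (ccomp c).
Definition clast n (c : ctriple n) : nat := last 0%N (ccomp c).

Definition is_component_triple n (G : graph n) (c : ctriple n) : bool :=
  [&& cedges c \subset gedges G,
      [forall e in cedges c, e \subset cvert c],
      subgraph_connected (cvert c) (cedges c),
      is_composition (ccomp c) #|cvert c|
    & (1 <= cmark c <= cfirst c)%N].

Definition is_subgraph_triple n (G : graph n) (S : {set ctriple n}) : bool :=
  [&& [forall c in S, is_component_triple G c],
      [forall c in S, forall d in S, (c != d) ==> [disjoint cvert c & cvert d]]
    & \bigcup_(c in S) cvert c == finset.setT].

Definition st_type n (S : {set ctriple n}) : seq nat :=
  sort geq (flatten [seq ccomp c | c <- enum S]).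

Definition st_sign n (S : {set ctriple n}) : {poly int} :=
  (-1) ^+ (n - size (st_type S)).

Definition st_edges n (S : {set ctriple n}) : nat := \sum_(c in S) #|cedges c|.

(* The member of S whose vertex set contains v; the default value is never
   reached when S is a subgraph triple. *)
Definition component_at n (S : {set ctriple n}) (v : 'I_n) : ctriple n :=
  odflt (CTriple finset.set0 finset.set0 [bseq] ord0) [pick c in S | v \in cvert c].

Definition st_rtype n (S : {set ctriple n.+1}) : seq nat :=
  rem (cfirst (component_at S ord0)) (st_type S).

(* Membership in ST^(i)(G + P_{j+1}), where G has m + 1 vertices.  The vertices
   labelled m + 1 (the last one of G), ..., m + 1 + j are those v with m <= v. *)
Definition in_ST m (G : graph m.+1) (i j : nat)
    (S : {set ctriple (m + j).+1}) : bool :=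
  let c := component_at S ord0 in
  let d := component_at S (inord m) in
  [&& is_subgraph_triple (graph_sum G (path_graph j.+1)) S,
      cfirst c == i,
      cmark c == 1%N :> nat,
      [set v : 'I_(m + j).+1 | m <= v]%N \subset cvert d
    & (j.+1 <= clast d)%N].

(* Matrices and vectors indexed by the positive integers are represented with
   indices shifted down by one: tutte_mx G i j is the entry (M_G)_{i+1,j+1}.
   Hence (-1) ^+ j is (-1)^{1-(j+1)}.  The subtraction in the exponent of t is
   never truncated, since the component containing the path has at least j
   edges. *)
Definition tutte_mx m (G : graph m.+1) (i j : nat) : symfun :=
  \sum_(S : {set ctriple (m + j).+1} | in_ST G i.+1 S)
    (st_sign S * (-1) ^+ j * 'X ^+ (st_edges S + 1 - j.+1)) *:
      elem_sym_seq (st_rtype S).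

Fact tutte_mx_eq0 m (G : graph m.+1) i j :
  (m + j < i)%N -> tutte_mx G i j = 0.
Proof.
move=> ltmi; apply: big_pred0 => S; apply/negP => /and5P[_ /eqP + _ _ _].
rewrite /cfirst /ccomp; case: (bseqval _) => [|k s] //= kE.
by have := ltn_ord k; rewrite kE !ltnS leqNgt ltmi.
Qed.

Definition inf_vecmx (R : pzRingType) (v : nat -> R) (M : nat -> nat -> R)
    (j : nat) : R :=
  \sum_(i \in [set: nat]%classic) v i * M i j.

Definition inf_dot (R : pzRingType) (v w : nat -> R) : R :=
  \sum_(j \in [set: nat]%classic) v j * w j.

Definition vec_v (i : nat) : symfun := elem_sym i.+1 *+ i.+1.
Definition vec_w (j : nat) : symfun := (j == 0%N)%:R.

(* Main.v *)
(* Expanding (1 + t)^e(kappa) over the sets F of monochromatic edges of kappa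
   gives XB_G as the sum over all F of t^|F| times the product of the power sums
   p_|B|, where B runs over the connected components of ([n], F).  Newton's
   identities give p_k as the sum of (-1)^(k - l(alpha)) alpha_1 e_alpha over the
   compositions alpha of k, the factor alpha_1 counting the marks r; expanding
   the product over the components yields one term for each subgraph triple.
   Restricting the sum to triples with r = 1 at vertex 1 costs the factor
   alpha_1 = i there, which v supplies in i e_i, while e_i restores the part
   removed from the reduced type.
   These are identities in finitely many variables; they carry over to power
   series because a power series is determined by its images under the ring
   morphisms killing all but the first N + 1 variables. *)

Require Import Defs.
From HB Require Import structures.
From mathcomp Require Import boolp classical_sets fsbigop.
From mathcomp Require Import all_boot all_algebra finmap monalg zify ring.

Set Implicit Arguments.
Unset Strict Implicit.
Unset Printing Implicit Defensive.

Import GRing.Theory.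
Local Open Scope ring_scope.

(** * Newton's identity in finitely many variables *)

Section Newton.
Context (R : comNzRingType) (T : finType) (x : T -> R).

Definition esymf k : R := \sum_(A : {set T} | #|A| == k) \prod_(c in A) x c.
Definition esymf_del c k : R :=
  \sum_(A : {set T} | (#|A| == k) && (c \notin A)) \prod_(d in A) x d.
Definition psum k : R := \sum_c x c ^+ k.

(** Adding and removing [c] are inverse bijections between the [k]-sets avoiding [c] and the
    [k.+1]-sets containing it. *)
Lemma esymf_mem c k :
  \sum_(A : {set T} | (#|A| == k.+1) && (c \in A)) \prod_(d in A) x d =
  x c * esymf_del c k.
Proof.
rewrite (reindex_onto (fun A => c |: A) (fun A => A :\ c)); last first.
  by move=> A /andP[_ cA]; rewrite setD1K.
rewrite mulr_sumr; apply: eq_big => [A|A /andP[/andP[_ _] /eqP cA]].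
  rewrite setU11 andbT; have [cA|cA] := boolP (c \in A); last first.
    by rewrite cardsU1 cA setU1K ?eqxx // andbT.
  rewrite andbF; apply/negP => /andP[_ /eqP] /setP/(_ c).
  by rewrite !inE eqxx cA.
by rewrite big_setU1 //= -cA !inE eqxx.
Qed.

Lemma esymf0 : esymf 0 = 1.
Proof.
rewrite /esymf (eq_bigl (pred1 set0)) ?big_pred1_eq ?big_set0 // => A.
by rewrite cards_eq0.
Qed.

Lemma esymf_del0 c : esymf_del c 0 = 1.
Proof.
rewrite /esymf_del (eq_bigl (pred1 set0)) ?big_pred1_eq ?big_set0 // => A /=.
by rewrite cards_eq0; case: eqP => // ->; rewrite inE.
Qed.

Lemma esymfS c k : esymf k.+1 = x c * esymf_del c k + esymf_del c k.+1.
Proof. by rewrite /esymf (bigID (fun A : {set T} => c \in A)) /= esymf_mem. Qed.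

(** [esymfS], solved for [esymf_del c k.+1], is a recursion in [k]; this is its unrolled form. *)
Lemma esymf_delE c k :
  esymf_del c k = \sum_(j < k.+1) (- x c) ^+ j * esymf (k - j)%N.
Proof.
elim: k => [|k IHk].
  by rewrite big_ord1 esymf0 esymf_del0 mulr1.
rewrite big_ord_recl /= expr0 mul1r subn0 (esymfS c) addrAC.
rewrite {1}IHk mulr_sumr -big_split big1 ?add0r //= => j _.
by rewrite exprS -mulrA mulNr subSS addrN.
Qed.

(* Both sides are the sum over c of x_c e_k(variables other than x_c). *)
Lemma newton_identity k :
  k.+1%:R * esymf k.+1 =
  \sum_(j < k.+1) (-1) ^+ j * psum j.+1 * esymf (k - j)%N.
Proof.
have -> : k.+1%:R * esymf k.+1 = \sum_c x c * esymf_del c k.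
  under eq_bigr do rewrite -esymf_mem.
  (* After the exchange each [k.+1]-set is counted once per element, hence the factor [k.+1]. *)
  rewrite (exchange_big_dep (fun A : {set T} => #|A| == k.+1)) /=; last first.
    by move=> c A _ /andP[].
  rewrite mulr_sumr; apply: eq_bigr => A /eqP Ak.
  by rewrite Ak eqxx sumr_const Ak mulr_natl.
under eq_bigr => c _ do rewrite esymf_delE mulr_sumr.
rewrite exchange_big; apply: eq_bigr => j _.
rewrite mulrAC mulrC /psum mulr_suml; apply: eq_bigr => c _ /=.
by rewrite exprS [X in _ * (X * _)]exprNn -!mulrA; congr (_ * _); rewrite mulrCA.
Qed.

End Newton.

(** * Enumeration of the compositions of an integer *)

Section Compositions.

(* [f] is fuel: the value is meaningful when n <= f. *)
Fixpoint compositions (f n : nat) : seq (seq nat) :=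
  if n is 0 then [:: [::]] else
  if f is f'.+1 then
    [seq rcons b k.+1 | k <- iota 0 n, b <- compositions f' (n - k.+1)]
  else [::].

Lemma compositionsS f n :
  compositions f.+1 n.+1 =
  [seq rcons b k.+1 | k <- iota 0 n.+1, b <- compositions f (n - k)].
Proof. by []. Qed.

Lemma is_composition_rcons b k n :
  is_composition (rcons b k) n =
  [&& (0 < k)%N, (k <= n)%N & is_composition b (n - k)].
Proof.
rewrite /is_composition all_rcons sumn_rcons.
by case: (all _ b); rewrite /= ?andbF // ?andbT; lia.
Qed.

Lemma mem_compositions f n s : (n <= f)%N ->
  (s \in compositions f n) = is_composition s n.
Proof.
elim: f n s => [|f IHf] [|n] s // nf.
- by case: s => [|[|a] s]; rewrite /is_composition //= andbF.
- by case: s => [|[|a] s]; rewrite /is_composition //= andbF.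
rewrite compositionsS; case/lastP: s => [|b k].
  rewrite [RHS]andbF; apply/negP => /allpairsPdep[k [b [_ _ bE]]].
  by case: b bE.
rewrite is_composition_rcons; apply/allpairsPdep/and3P => [[k' [b' []]]|[]].
  rewrite mem_iota => kn + /rcons_inj[-> ->]; rewrite IHf; last lia.
  by split.
case: k => // k _ kn bP; exists k, b; split=> //; first by rewrite mem_iota.
by rewrite IHf //; lia.
Qed.

Lemma compositions_uniq f n : uniq (compositions f n).
Proof.
elim: f n => [|f IHf] [|n] //; rewrite compositionsS.
rewrite (allpairs_uniq_dep (iota_uniq 0 n.+1)) //.
by move=> [k b] [k' b'] _ _ /= /rcons_inj[-> ->].
Qed.

Lemma size_composition s n : is_composition s n -> (size s <= n)%N.
Proof.
case/andP => + /eqP <-; elim: s => //= k s IHs /andP[k0 /IHs].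
by rewrite -add1n; exact: leq_add.
Qed.

Lemma composition_part_le s n k : is_composition s n -> k \in s -> (k <= n)%N.
Proof.
case/andP => _ /eqP <-; elim: s => //= a s IHs; rewrite inE => /predU1P[->|/IHs].
  exact: leq_addr.
by move/leq_trans; apply; exact: leq_addl.
Qed.

(** The bounded encoding loses nothing: a composition of [k <= n] has at most [n] parts, each at
    most [n]. *)
Lemma big_bseq_composition (R : nmodType) n k (F : seq nat -> R) : (k <= n)%N ->
  \sum_(a : n.-bseq 'I_n.+1 | is_composition [seq nat_of_ord i | i <- a] k)
    F [seq nat_of_ord i | i <- a] = \sum_(s <- compositions n k) F s.
Proof.
move=> kn.
pose h (a : n.-bseq 'I_n.+1) := [seq nat_of_ord i | i <- a].
have hI : injective h by move=> a b /(inj_map val_inj)/val_inj.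
rewrite -(big_filter _ (fun a => is_composition (h a) k)) -(big_map h xpredT F).
apply: perm_big; apply: uniq_perm; rewrite ?compositions_uniq //.
  by rewrite map_inj_uniq // filter_uniq // index_enum_uniq.
move=> s; rewrite mem_compositions //; apply/mapP/idP => [[a + ->]|sk].
  by rewrite mem_filter => /andP[].
have sn : (size [seq inord i : 'I_n.+1 | i <- s] <= n)%N.
  by rewrite size_map (leq_trans (size_composition sk)).
have hs : h (Bseq sn) = s.
  rewrite /h /= -map_comp map_id_in // => i /(composition_part_le sk) ik /=.
  by rewrite inordK // ltnS (leq_trans ik).
exists (Bseq sn); last by rewrite hs.
by rewrite mem_filter mem_index_enum hs sk.
Qed.

End Compositions.

(** * Power sums as signed sums over compositions *)

Section PowerSum.
Context (R : comNzRingType) (T : finType) (x : T -> R).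

Definition comp_weight n (s : seq nat) : R :=
  (-1) ^+ (n - size s) * \prod_(k <- s) esymf x k.

(** Induction by removing the last part: this keeps the first part, which is the multiplicity,
    unless there is only one part. The sum over last parts is then Newton's identity. *)
Lemma psum_compositions f n : (0 < n)%N -> (n <= f)%N ->
  \sum_(s <- compositions f n) comp_weight n s *+ head 0%N s = psum x n.
Proof.
elim: f n => [|f IHf] [|n] // _ nf; rewrite compositionsS big_allpairs_dep.
(* The top index is the one-part composition, whose first part is [n.+1] itself. *)
rewrite -[iota 0 n.+1]/(index_iota 0 n.+1) big_nat_recr //= subnn.
have -> : compositions f 0 = [:: [::]] by case: f {IHf nf}.
rewrite big_seq1 /comp_weight /= big_seq1 subn1 /=.
(* [p k] is the total for last part [k.+1], the other parts giving [psum x (n - k)] by induction. *)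
pose p k := (-1) ^+ k * esymf x k.+1 * psum x (n - k).
rewrite (eq_big_nat _ _ (F2 := p)) => [|k kn].
  (* The top term of Newton's identity gives [psum x n.+1], its two signs [(-1) ^+ n] cancelling;
     the other terms cancel against the [p k] once the index is reversed. *)
  rewrite -mulr_natl mulrCA newton_identity big_ord_recr /= subnn esymf0 mulr1.
  rewrite mulrDr mulrA -exprD addnn -mul2n exprM sqrrN !expr1n mul1r.
  rewrite addrA [X in X + _](_ : _ = 0) ?add0r // big_mkord (reindex_inj rev_ord_inj).
  rewrite mulr_sumr -big_split big1 //= => k _; rewrite /p.
  rewrite (_ : (n - (n - k.+1)) = k.+1)%N; last by case: k => k /=; lia.
  rewrite (_ : (n - k.+1).+1 = n - k)%N; last by case: k => k /=; lia.
  have -> : (-1) ^+ n = - ((-1) ^+ (n - k.+1) * (-1) ^+ k) :> R.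
    rewrite -exprD -[RHS]mulN1r -exprS; congr (_ ^+ _).
    by case: k => k /=; lia.
  have ss : (-1) ^+ k * (-1) ^+ k = 1 :> R by rewrite -expr2 sqrr_sign.
  by ring: ss.
transitivity (\sum_(b <- compositions f (n - k))
    ((-1) ^+ k * esymf x k.+1) * (comp_weight (n - k) b *+ head 0%N b)).
  apply: eq_big_seq => b; rewrite mem_compositions; last lia.
  move=> bP; have sb := size_composition bP.
  rewrite size_rcons -cats1 big_cat big_seq1 /= /comp_weight mulrnAr.
  congr (_ *+ _); last first.
    by case: b bP sb => [|//]; rewrite /is_composition /=; lia.
  rewrite (_ : n.+1 - _ = k + (n - k - size b))%N ?exprD; first by ring.
  by rewrite subSS; move: (size b) kn sb => sz; lia.
by rewrite -mulr_sumr IHf; [|lia|lia].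
Qed.

End PowerSum.

(** * Connected components of a spanning subgraph *)

Section Components.
Context (n : nat).
Implicit Types (F : {set {set 'I_n}}) (B : {set 'I_n}) (S : {set ctriple n}).

Definition edge_rel F : rel 'I_n := fun x y => [set x; y] \in F.
Definition gcomp F : {set {set 'I_n}} :=
  equivalence_partition (connect (edge_rel F)) [set: 'I_n].
Definition edges_in F B : {set {set 'I_n}} := [set e in F | e \subset B].

Lemma edge_rel_sym F : symmetric (edge_rel F).
Proof. by move=> x y; rewrite /edge_rel setUC. Qed.

Lemma connect_edge_sym F : connect_sym (edge_rel F).
Proof. exact/sym_connect_sym/edge_rel_sym. Qed.

Lemma connect_edge_equiv F :
  {in [set: 'I_n] & &, equivalence_rel (connect (edge_rel F))}.
Proof.
move=> x y z _ _ _; split; first exact: connect0.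
by move=> xy; exact: same_connect (@connect_edge_sym F) _ _ xy _.
Qed.

Lemma gcomp_partition F : partition (gcomp F) [set: 'I_n].
Proof. exact/equivalence_partitionP/connect_edge_equiv. Qed.

Lemma gcomp_trivIset F : trivIset (gcomp F).
Proof. exact: partition_trivIset (gcomp_partition F). Qed.

Lemma gcomp_cover F : cover (gcomp F) = [set: 'I_n].
Proof. exact: cover_partition (gcomp_partition F). Qed.

Lemma mem_gcomp F B u v : B \in gcomp F -> u \in B ->
  (v \in B) = connect (edge_rel F) u v.
Proof.
move=> BF uB; rewrite -(def_pblock (gcomp_trivIset F) BF uB).
by rewrite (pblock_equivalence_partition (@connect_edge_equiv F)) ?inE.
Qed.

Lemma gcomp_neq0 F B : B \in gcomp F -> exists u, u \in B.
Proof. by move/(partition_neq0 (gcomp_partition F))/set0Pn. Qed.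

Lemma pblock_gcomp F u : pblock (gcomp F) u \in gcomp F.
Proof. by rewrite pblock_mem // gcomp_cover inE. Qed.

Lemma mem_pblock_gcomp F u : u \in pblock (gcomp F) u.
Proof. by rewrite mem_pblock gcomp_cover inE. Qed.

Lemma pblock_gcompE F B u : u \in B ->
  (forall v, connect (edge_rel F) u v = (v \in B)) -> B = pblock (gcomp F) u.
Proof.
move=> uB FB; apply/setP => v.
by rewrite [RHS](@mem_gcomp F _ u) ?pblock_gcomp ?mem_pblock_gcomp.
Qed.

(** A path from a vertex of [B] never leaves [B], so its edges all lie in [edges_in F B]. *)
Lemma gcomp_connected F B : B \in gcomp F -> subgraph_connected B (edges_in F B).
Proof.
move=> BF; rewrite /subgraph_connected (partition_neq0 (gcomp_partition F) BF) /=.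
apply/forall_inP => u uB; apply/forall_inP => v.
rewrite (mem_gcomp _ BF uB) => /connectP[p + ->].
elim: p u uB => [|y p IHp] u uB /=; first by rewrite connect0.
move=> /andP[uy yp].
have yB : y \in B by rewrite (mem_gcomp _ BF uB) connect1.
apply: connect_trans (IHp _ yB yp); apply: connect1.
rewrite inE; apply/andP; split=> //.
by apply/subsetP => z; rewrite !inE => /orP[] /eqP->.
Qed.

Lemma edge_sub_gcomp F (e : {set 'I_n}) u : #|e| = 2 -> e \in F -> u \in e ->
  e \subset pblock (gcomp F) u.
Proof.
move=> e2 eF ue; apply/subsetP => v ve.
rewrite (@mem_gcomp F _ u) ?pblock_gcomp ?mem_pblock_gcomp //.
have [->|uv] := eqVneq u v; first exact: connect0.
apply: connect1; rewrite /edge_rel (_ : [set u; v] = e) //.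
apply/eqP; rewrite eqEcard cards2 uv e2 leqnn andbT.
by apply/subsetP => z; rewrite !inE => /orP[] /eqP->.
Qed.

Lemma edges_in_gcomp F : {in F, forall e : {set 'I_n}, #|e| = 2} ->
  \bigcup_(B in gcomp F) edges_in F B = F.
Proof.
move=> F2; apply/setP => e; apply/bigcupP/idP => [[B _]|eF].
  by rewrite inE => /andP[].
have /set0Pn[u ue] : e != set0 by rewrite -card_gt0 F2.
exists (pblock (gcomp F) u); first exact: pblock_gcomp.
by rewrite inE eF edge_sub_gcomp ?F2.
Qed.

Context (G : graph n).

Definition st_edge_set S : {set {set 'I_n}} := \bigcup_(c in S) cedges c.

Lemma st_triple S c : is_subgraph_triple G S -> c \in S -> is_component_triple G c.
Proof. by case/and3P => /forall_inP + _ _; apply. Qed.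

Lemma st_cvert_inj S c d u : is_subgraph_triple G S -> c \in S -> d \in S ->
  u \in cvert c -> u \in cvert d -> c = d.
Proof.
case/and3P => _ /forall_inP disj _ cS dS uc ud; apply/eqP.
have := forall_inP (disj c cS) d dS; have [//|/= _] := eqVneq c d.
by move=> /pred0P/(_ u); rewrite /= uc ud.
Qed.

Lemma st_cover S u : is_subgraph_triple G S -> exists2 c, c \in S & u \in cvert c.
Proof.
case/and3P => _ _ /eqP cov; apply/bigcupP.
by rewrite cov inE.
Qed.

Lemma ctriple_edge_sub c e : is_component_triple G c -> e \in cedges c ->
  e \subset cvert c.
Proof. by case/and5P => _ /forall_inP + _ _ _; apply. Qed.

(** Edges are nonempty, so an edge of another member lying inside [cvert c] would give two members a
    common vertex. *)
Lemma st_edges_in S c : is_subgraph_triple G S -> c \in S ->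
  cedges c = edges_in (st_edge_set S) (cvert c).
Proof.
move=> ST cS; have cT := st_triple ST cS.
apply/setP => e; rewrite inE; apply/idP/andP => [ec|[/bigcupP[d dS ed] ec]].
  by split; [apply/bigcupP; exists c | exact: ctriple_edge_sub].
have dT := st_triple ST dS.
have : #|e| = 2 by apply: (@card_gedge _ G); case/and5P: dT => /subsetP + _ _ _ _; apply.
move=> e2; have /set0Pn[u ue] : e != set0 by rewrite -card_gt0 e2.
suff -> : c = d by [].
apply: (@st_cvert_inj S c d u) => //; first exact: (subsetP ec).
exact: (subsetP (ctriple_edge_sub dT ed)).
Qed.

(** One direction holds because [cvert c] is closed under the edges of [S], the other because [c]
    itself is connected. *)
Lemma st_connect S c u v : is_subgraph_triple G S -> c \in S -> u \in cvert c ->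
  connect (edge_rel (st_edge_set S)) u v = (v \in cvert c).
Proof.
move=> ST cS uc; apply/idP/idP => [|vc].
  move=> /(@closed_connect _ _ (mem (cvert c))) <- //.
  apply: intro_closed => [|x y /bigcupP[d dS xyd] xc]; first exact: connect_edge_sym.
  have /subsetP xyS := ctriple_edge_sub (st_triple ST dS) xyd.
  have xd : x \in cvert d by apply: xyS; rewrite !inE eqxx.
  rewrite (st_cvert_inj ST cS dS xc xd).
  by apply: xyS; rewrite !inE eqxx orbT.
have /and5P[_ _ /andP[_ /forall_inP conn] _ _] := st_triple ST cS.
apply: connect_sub (forall_inP (conn u uc) v vc) => x y xy.
by apply: connect1; apply/bigcupP; exists c.
Qed.

Lemma ctriple_vert_neq0 c : is_component_triple G c -> exists u, u \in cvert c.
Proof. by case/and5P => _ _ /andP[/set0Pn]. Qed.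

Lemma gcomp_st S : is_subgraph_triple G S ->
  gcomp (st_edge_set S) = [set cvert c | c in S].
Proof.
move=> ST.
have cE c u : c \in S -> u \in cvert c -> cvert c = pblock (gcomp (st_edge_set S)) u.
  by move=> cS uc; apply: pblock_gcompE => // v; exact: st_connect.
apply/setP => B; apply/idP/imsetP => [BF|[c cS ->]].
  have [u uB] := gcomp_neq0 BF; have [c cS uc] := st_cover u ST.
  by exists c => //; rewrite (cE c u) // (def_pblock (gcomp_trivIset _) BF).
have [u uc] := ctriple_vert_neq0 (st_triple ST cS).
by rewrite (cE c u) // pblock_gcomp.
Qed.

End Components.

(** * Monochromatic colourings and power sums *)

Section Colorings.
Context (R : comNzRingType) (T : finType) (t0 : T) (x : T -> R) (n : nat).

Definition monochromatic (F : {set {set 'I_n}}) (kappa : {ffun 'I_n -> T}) :=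
  [forall e in F, [forall u in e, forall v in e, kappa u == kappa v]].

Lemma monochromaticP (F : {set {set 'I_n}}) (kappa : {ffun 'I_n -> T}) :
  {in F, forall e : {set 'I_n}, #|e| = 2} ->
  reflect (forall u v, connect (edge_rel F) u v -> kappa u = kappa v)
          (monochromatic F kappa).
Proof.
move=> F2; apply: (iffP idP) => [kF u v|kF].
  case/connectP => p + ->; elim: p u => //= y p IHp u /andP[uy /IHp <-].
  have := forall_inP (forall_inP (forall_inP kF _ uy) u _) y.
  by rewrite !inE !eqxx orbT => /(_ isT isT)/eqP.
apply/forall_inP => e eF; apply/forall_inP => u ue; apply/forall_inP => v ve.
apply/eqP/kF; rewrite -(@mem_gcomp _ F (pblock (gcomp F) u)).
- by apply: (subsetP (edge_sub_gcomp (F2 e eF) eF ue)).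
- exact: pblock_gcomp.
- exact: mem_pblock_gcomp.
Qed.

(** Such a colouring amounts to one free colour per component of [F]; a component [B] of colour [c]
    contributes [x c ^+ #|B|]. *)
Lemma sum_monochromatic (F : {set {set 'I_n}}) :
  {in F, forall e : {set 'I_n}, #|e| = 2} ->
  \sum_(kappa | monochromatic F kappa) \prod_v x (kappa v) =
  \prod_(B in gcomp F) psum x #|B|.
Proof.
move=> F2; rewrite /psum (big_distr_big t0) /=.
pose h (g : {ffun {set 'I_n} -> T}) := [ffun v => g (pblock (gcomp F) v)].
(* [h'] reads the colour of a component at an arbitrary vertex; [t0] is the default that
   [big_distr_big] imposes off [gcomp F]. *)
pose h' (kappa : {ffun 'I_n -> T}) : {ffun {set 'I_n} -> T} :=
  [ffun B => if B \in gcomp F then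
               if [pick v in B] is Some v then kappa v else t0 else t0].
have h'E kappa B v : monochromatic F kappa -> B \in gcomp F -> v \in B ->
    h' kappa B = kappa v.
  move=> /(monochromaticP _ F2) kF BF vB; rewrite ffunE BF.
  case: pickP => [u uB|/(_ v)]; last by rewrite vB.
  by apply: kF; rewrite -(@mem_gcomp _ F B).
have hmono g : monochromatic F (h g).
  apply/(monochromaticP _ F2) => u v uv; rewrite !ffunE; congr (g _).
  apply/esym/same_pblock; first exact: gcomp_trivIset.
  by rewrite (@mem_gcomp _ F _ u) ?pblock_gcomp ?mem_pblock_gcomp.
rewrite (reindex_onto h h') => [|kappa km]; last first.
  apply/ffunP => v; rewrite ffunE (h'E _ _ v) ?pblock_gcomp //.
  exact: mem_pblock_gcomp.
apply: eq_big => g.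
  rewrite hmono /=; apply/eqP/pffun_onP => [<-|[/supportP g0 _]].
    by split=> //; apply/supportP => B /negPf BF; rewrite ffunE BF.
  apply/ffunP => B; have [BF|BF] := boolP (B \in gcomp F); last first.
    by rewrite ffunE (negPf BF) g0.
  have [v vB] := gcomp_neq0 BF.
  by rewrite (h'E _ _ v) // ffunE (def_pblock (gcomp_trivIset F) BF vB).
move=> _; rewrite -(eq_bigl _ _ (fun v => in_setT v)).
rewrite (set_partition_big _ (gcomp_partition F)) /=.
apply: eq_bigr => B BF; rewrite -prodr_const; apply: eq_bigr => v vB.
by rewrite ffunE (def_pblock (gcomp_trivIset F) BF vB).
Qed.

End Colorings.

(** * Subgraph triples with a given edge set *)

Section Decomposition.
Context (n : nat) (G : graph n) (v0 : 'I_n).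
Implicit Types (F : {set {set 'I_n}}) (B : {set 'I_n}).

(** The possible members on the component [B] of a triple with edge set [F]: the graph is forced,
    the composition is free, and so is the mark unless [v0] lies in [B]. *)
Definition marked_block (F : {set {set 'I_n}}) B (c : ctriple n) :=
  [&& cvert c == B, cedges c == edges_in F B, is_composition (ccomp c) #|B|,
      (1 <= cmark c <= cfirst c)%N & (v0 \in B) ==> (cmark c == 1 :> nat)%N].

Definition marked_triple (S : {set ctriple n}) :=
  is_subgraph_triple G S &&
  [forall c in S, (v0 \in cvert c) ==> (cmark c == 1 :> nat)%N].

Definition ctriple0 : ctriple n := CTriple set0 set0 [bseq] ord0.

Lemma marked_block_triple F B c : F \subset gedges G -> B \in gcomp F ->
  marked_block F B c -> is_component_triple G c.
Proof.
move=> /subsetP FG BF /and5P[/eqP cB /eqP cF cc cm _].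
apply/and5P; split; rewrite ?cB ?cF //.
- by apply/subsetP => e; rewrite inE => /andP[/FG].
- by apply/forall_inP => e; rewrite inE => /andP[].
- exact: gcomp_connected.
Qed.

(* A triple with edge set F is the choice of a marked composition for each
   component of F, so this is distributivity of product over sum. *)
Lemma sum_marked_triple (R : comNzRingType) (w : ctriple n -> R)
    (F : {set {set 'I_n}}) : F \subset gedges G ->
  \sum_(S | marked_triple S && (st_edge_set S == F)) \prod_(c in S) w c =
  \prod_(B in gcomp F) \sum_(c | marked_block F B c) w c.
Proof.
move=> FG; rewrite (big_distr_big_dep ctriple0) /=.
have F2 : {in F, forall e : {set 'I_n}, #|e| = 2}.
  by move=> e eF; apply: (@card_gedge _ G); apply: (subsetP FG).
(* A choice function [f] gives the triple [h f]; conversely [h' S] finds the member of [S] on each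
   component. *)
pose h (f : {ffun {set 'I_n} -> ctriple n}) := [set f B | B in gcomp F].
pose h' (S : {set ctriple n}) : {ffun {set 'I_n} -> ctriple n} :=
  [ffun B => if B \in gcomp F then
     odflt ctriple0 [pick c in S | cvert c == B] else ctriple0].
have h'E S c : is_subgraph_triple G S -> st_edge_set S = F -> c \in S ->
    h' S (cvert c) = c.
  move=> ST SF cS; rewrite ffunE -SF (gcomp_st ST) imset_f //.
  have [u uc] := ctriple_vert_neq0 (st_triple ST cS).
  case: pickP => [d /andP[dS /eqP dc]|/(_ c)]; last by rewrite cS eqxx.
  by apply: (@st_cvert_inj _ G S d c u); rewrite ?dc.
rewrite (reindex_onto h h') => [|S /andP[/andP[ST _] /eqP SF]]; last first.
  rewrite /h -[in gcomp F]SF (gcomp_st ST) -imset_comp.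
  by rewrite -[RHS]imset_id; apply: eq_in_imset => c cS /=; rewrite h'E.
have famP f : reflect (f \in pfamily ctriple0 (gcomp F) (marked_block F))
   [&& marked_triple (h f), st_edge_set (h f) == F & h' (h f) == f].
  apply: (iffP and3P) => [[/andP[ST mk] /eqP SF /eqP hf]|/pfamilyP[/supportP f0 fQ]].
    apply/pfamilyP; split=> [|B BF].
      by apply/supportP => B /negPf BF; rewrite -hf ffunE BF.
    have : B \in gcomp F by [].
    rewrite -{1}SF (gcomp_st ST) => /imsetP[c cS ->].
    rewrite -hf h'E // -topredE /=.
    have /and5P[_ _ _ cc cm] := st_triple ST cS.
    apply/and5P; split=> //; last exact: (forall_inP mk c cS).
    by rewrite {1}(st_edges_in ST cS) SF.
  have fB B : B \in gcomp F -> cvert (f B) = B.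
    by move=> /fQ /and5P[/eqP].
  have SF : st_edge_set (h f) = F.
    rewrite -[RHS](edges_in_gcomp F2) /st_edge_set.
    apply/setP => e; apply/bigcupP/bigcupP => [[_ /imsetP[B BF ->]]|[B BF eB]].
      by have /and5P[_ /eqP -> _ _ _] := fQ B BF; exists B.
    exists (f B); first exact: imset_f.
    by have /and5P[_ /eqP -> _ _ _] := fQ B BF.
  split; [apply/andP; split| exact/eqP|].
  - apply/and3P; split.
    + apply/forall_inP => _ /imsetP[B BF ->].
      exact: (marked_block_triple FG BF (fQ B BF)).
    + apply/forall_inP => _ /imsetP[B BF ->]; apply/forall_inP => _ /imsetP[D DF ->].
      apply/implyP => BD; rewrite !fB //.
      apply: (trivIsetP (gcomp_trivIset F)) => //.
      by apply: contraNneq BD => ->.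
    + apply/eqP/setP => v; rewrite inE; apply/bigcupP.
      exists (f (pblock (gcomp F) v)); first by apply/imset_f/pblock_gcomp.
      by rewrite fB ?pblock_gcomp ?mem_pblock_gcomp.
  - apply/forall_inP => _ /imsetP[B BF ->].
    by rewrite fB //; have /and5P[] := fQ B BF.
  - apply/eqP/ffunP => B; rewrite ffunE; case: ifPn => [BF|/f0->//].
    case: pickP => [c /andP[/imsetP[D DF ->]]|/(_ (f B))].
      by rewrite fB // => /eqP ->.
    by rewrite imset_f // fB // eqxx.
apply: eq_big => [f|f]; first by rewrite -andbA; apply/idP/idP => /famP.
rewrite -andbA => /famP /pfamilyP[_ fQ].
(* [f] is injective on [gcomp F], since [f B] has vertex set [B]. *)
rewrite big_imset //= => B D BF DF fBD.
have /and5P[/eqP <- _ _ _ _] := fQ B BF.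
by rewrite fBD; have /and5P[/eqP -> _ _ _ _] := fQ D DF.
Qed.

End Decomposition.

(** The binomial theorem, with the subsets grouped by size; [inord] is exact as [#|F| <= #|A|]. *)
Lemma sum_subset_expr (R : comNzRingType) (T : finType) (A : {set T}) (t : R) :
  \sum_(F : {set T} | F \subset A) t ^+ #|F| = (1 + t) ^+ #|A|.
Proof.
rewrite exprDn (partition_big (fun F : {set T} => inord #|F| : 'I_#|A|.+1) xpredT) //=.
apply: eq_bigr => i _; rewrite expr1n mul1r -cards_draws -sumr_const.
have cE (F : {set T}) : F \subset A -> (inord #|F| == i) = (#|F| == i).
  by move=> /subset_leq_card FA; rewrite -val_eqE /= inordK.
apply: eq_big => [F|F /andP[FA]]; first by rewrite inE; apply: andb_id2l => /cE.
by rewrite cE // => /eqP ->.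
Qed.

(** The set counted by [mono_edges], for colours in a finite type, so that colourings form a finite
    index set. *)
Definition mono_edge_set (T : finType) n (G : graph n) (kappa : {ffun 'I_n -> T}) :=
  [set e in gedges G | [forall u in e, forall v in e, kappa u == kappa v]].

(** * The identity in finitely many variables *)

Section FiniteVariables.
Context (R : comNzRingType) (T : finType) (t0 : T) (x : T -> R) (t : R).
Context (n : nat) (G : graph n) (v0 : 'I_n).
Implicit Types (F : {set {set 'I_n}}) (B : {set 'I_n}).

(* The mark of the component of [v0] is forced to be 1, and the factor [cfirst c]
   makes up for the marks thus left out. *)
Definition ctriple_weight (c : ctriple n) : R :=
  comp_weight x #|cvert c| (ccomp c) * t ^+ #|cedges c| *+
    (if v0 \in cvert c then cfirst c else 1).

(** Either the single mark 1 is counted [a] times, or the marks from 1 to [a] once each. *)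
Lemma card_marks (a : nat) (b : bool) : (0 < a <= n)%N ->
  (#|[pred r : 'I_n.+1 | (0 < r <= a)%N && (b ==> (r == 1 :> nat))]| *
     (if b then a else 1) = a)%N.
Proof.
case/andP=> a0 an; case: b => /=.
  rewrite (eq_card (B := pred1 (inord 1))) ?card1 ?mul1n // => r.
  rewrite !inE -val_eqE /= inordK; last by rewrite ltnS (leq_trans a0).
  by case: eqP => [->|]; rewrite ?andbT ?andbF // a0.
rewrite muln1 -[RHS]card_ord -(card_image (f := fun r : 'I_a => inord r.+1 : 'I_n.+1)).
  apply: eq_card => r; rewrite !inE andbT; apply/idP/imageP => [/andP[r0 ra]|[i _ ->]].
    have ra' : (r.-1 < a)%N by rewrite prednK.
    by exists (Ordinal ra') => //; apply/val_inj; rewrite /= prednK // inord_val.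
  by rewrite inordK ?ltn_ord // ltnS (leq_trans (ltn_ord i)).
move=> i j /(congr1 (@nat_of_ord _)); rewrite !inordK; last 2 first.
- by rewrite ltnS (leq_trans (ltn_ord j)).
- by rewrite ltnS (leq_trans (ltn_ord i)).
by case=> /val_inj.
Qed.

(** By [card_marks] each composition is counted as often as its first part says, which gives the sum
    in [psum_compositions]. *)
Lemma sum_marked_block F B : B \in gcomp F ->
  \sum_(c | marked_block v0 F B c) ctriple_weight c =
  t ^+ #|edges_in F B| * psum x #|B|.
Proof.
move=> BF.
have B0 : (0 < #|B|)%N by have [u uB] := gcomp_neq0 BF; apply/card_gt0P; exists u.
have Bn : (#|B| <= n)%N by rewrite -[X in (_ <= X)%N]card_ord max_card.
rewrite -(@psum_compositions _ _ _ n) // -(big_bseq_composition _ Bn) mulr_sumr.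
rewrite (reindex_onto (fun p : n.-bseq 'I_n.+1 * 'I_n.+1 =>
  CTriple B (edges_in F B) p.1 p.2) (fun c => (ccomp_ord c, cmark c))) /=; last first.
  by case=> V E a r /= /and5P[/eqP/= -> /eqP/= ->].
rewrite (eq_bigl (fun p : n.-bseq 'I_n.+1 * 'I_n.+1 =>
  is_composition [seq nat_of_ord i | i <- p.1] #|B| &&
  ((1 <= p.2 <= head 0%N [seq nat_of_ord i | i <- p.1])%N &&
    ((v0 \in B) ==> (p.2 == 1 :> nat)%N)))); last first.
  by move=> [a r]; rewrite /marked_block /= !eqxx andbT.
rewrite -(pair_big_dep (fun a : n.-bseq 'I_n.+1 =>
    is_composition [seq nat_of_ord i | i <- a] #|B|)
  (fun (a : n.-bseq 'I_n.+1) (r : 'I_n.+1) =>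
    (1 <= r <= head 0%N [seq nat_of_ord i | i <- a])%N &&
    ((v0 \in B) ==> (r == 1 :> nat)%N))
  (fun (a : n.-bseq 'I_n.+1) (r : 'I_n.+1) =>
    ctriple_weight (CTriple B (edges_in F B) a r))) /=.
apply: eq_bigr => a aB; set f := head _ _.
transitivity (\sum_(r in [pred r : 'I_n.+1 |
    (0 < r <= f)%N && ((v0 \in B) ==> (r == 1 :> nat))])
  (comp_weight x #|B| [seq nat_of_ord i | i <- a] * t ^+ #|edges_in F B|) *+
    (if v0 \in B then f else 1)); first by [].
rewrite sumr_const -mulrnA mulnC card_marks /f.
  by rewrite mulrnAr mulrC.
(* [card_marks] asks for a positive first part: [B] is nonempty, so its composition is too. *)
case: (val a) aB => [|i s] aB /=.
  by move: aB B0; rewrite /is_composition /= => /eqP <-.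
by rewrite -[X in _ && X]/(i < n.+1)%N ltn_ord andbT; case/andP: aB => /andP[].
Qed.

(** Every edge lies inside exactly one component. *)
Lemma prod_gcomp_edges F : {in F, forall e : {set 'I_n}, #|e| = 2} ->
  \prod_(B in gcomp F) t ^+ #|edges_in F B| = t ^+ #|F|.
Proof.
move=> F2; rewrite -expr_sum; congr (_ ^+ _).
rewrite -[X in _ = #|pred_of_set X|](edges_in_gcomp F2) -[RHS]sum1_card.
have disj B D e : B \in gcomp F -> D \in gcomp F -> e \in edges_in F B ->
    e \in edges_in F D -> B = D.
  rewrite !inE => BF DF /andP[eF /subsetP eB] /andP[_ /subsetP eD].
  have /set0Pn[u ue] : e != set0 by rewrite -card_gt0 F2.
  rewrite -(def_pblock (gcomp_trivIset F) BF (eB u ue)).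
  exact: def_pblock (gcomp_trivIset F) DF (eD u ue).
rewrite [RHS](partition_big
  (fun e => odflt set0 [pick B in gcomp F | e \in edges_in F B])
  (mem (gcomp F))) /=.
  apply: eq_bigr => B BF; rewrite -sum1_card; apply: eq_bigl => e.
  apply/idP/andP => [eB|[/bigcupP[D DF eD]]].
    split; first by apply/bigcupP; exists B.
    case: pickP => [D /andP[DF eD]|/(_ B)]; last by rewrite BF eB.
    by rewrite (disj _ _ _ BF DF eB eD).
  case: pickP => [D' /andP[DF' eD'] /= /eqP <- //|/(_ D)].
  by rewrite DF eD.
move=> e /bigcupP[D DF eD]; case: pickP => [D' /andP[]//|/(_ D)].
by rewrite DF eD.
Qed.

Lemma finite_tutte :
  \sum_(kappa : {ffun 'I_n -> T})
    (1 + t) ^+ #|mono_edge_set G kappa| *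
      \prod_v x (kappa v) =
  \sum_(S | marked_triple G v0 S) \prod_(c in S) ctriple_weight c.
Proof.
have F2 F : F \subset gedges G -> {in F, forall e : {set 'I_n}, #|e| = 2}.
  by move=> FG e eF; apply: (@card_gedge _ G); apply: (subsetP FG).
transitivity (\sum_(kappa : {ffun 'I_n -> T})
    \sum_(F : {set {set 'I_n}} | F \subset mono_edge_set G kappa)
                t ^+ #|F| * \prod_v x (kappa v)).
  apply: eq_bigr => kappa _; rewrite -mulr_suml; congr (_ * _).
  by rewrite sum_subset_expr.
rewrite (exchange_big_dep
  (fun F : {set {set 'I_n}} => F \subset gedges G)) /=; last first.
  move=> kappa F _ /subset_trans; apply; apply/subsetP => e.
  by rewrite inE => /andP[].
(* Triples are grouped by edge set, so that the two sides are compared one [F] at a time. *)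
rewrite [RHS](partition_big (@st_edge_set n)
  (fun F : {set {set 'I_n}} => F \subset gedges G)) /=; last first.
  move=> S /andP[ST _]; apply/bigcupsP => c cS.
  by case/and5P: (st_triple ST cS).
apply: eq_bigr => F FG; rewrite sum_marked_triple //.
under [RHS]eq_bigr => B BF do rewrite sum_marked_block //.
rewrite big_split /= prod_gcomp_edges; last exact: F2.
rewrite -(sum_monochromatic t0) ?mulr_sumr; last exact: F2.
apply: eq_bigl => kappa; apply/subsetP/forall_inP => FM e eF.
  by have := FM e eF; rewrite inE => /andP[].
by rewrite inE (subsetP FG) // FM.
Qed.

End FiniteVariables.

(** * The weight of a subgraph triple *)

Section TripleWeight.
Context (n : nat) (G : graph n) (v0 : 'I_n) (S : {set ctriple n}).
Hypothesis ST : is_subgraph_triple G S.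

Lemma component_atE c v : c \in S -> v \in cvert c -> component_at S v = c.
Proof.
move=> cS vc; rewrite /component_at; case: pickP => [d /andP[dS vd]|/(_ c)].
  exact: st_cvert_inj ST dS cS vd vc.
by rewrite cS vc.
Qed.

Lemma component_at_mem v : component_at S v \in S /\ v \in cvert (component_at S v).
Proof. by have [c cS vc] := st_cover v ST; rewrite (component_atE cS vc). Qed.

Lemma big_st_type (R : Type) (idx : R) (op : Monoid.com_law idx) (f : nat -> R) :
  \big[op/idx]_(k <- st_type S) f k =
  \big[op/idx]_(c in S) \big[op/idx]_(k <- ccomp c) f k.
Proof.
rewrite /st_type (perm_big _ (permEl (perm_sort _ _))) big_flatten big_map.
by rewrite big_enum.
Qed.

Lemma sum_card_cvert : \sum_(c in S) #|cvert c| = n.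
Proof.
rewrite -[RHS]card_ord -sum1_card.
rewrite (partition_big (component_at S) (mem S)) /=; last first.
  by move=> v _; case: (component_at_mem v).
apply: eq_bigr => c cS; rewrite -sum1_card; apply: eq_bigl => v.
apply/idP/eqP => [|<-]; first exact: component_atE.
by case: (component_at_mem v).
Qed.

Lemma st_size_ccomp c : c \in S -> (size (ccomp c) <= #|cvert c|)%N.
Proof. by move=> cS; have /and5P[_ _ _ /size_composition] := st_triple ST cS. Qed.

(** Over the members, vertex counts add up to [n] and lengths to that of the type; the multiplicity
    comes only from the member containing [v0]. *)
Lemma prod_ctriple_weight (R : comNzRingType) (T : finType) (x : T -> R) (t : R) :
  \prod_(c in S) ctriple_weight x t v0 c =
  ((-1) ^+ (n - size (st_type S)) * t ^+ st_edges S *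
    \prod_(k <- st_type S) esymf x k) *+ cfirst (component_at S v0).
Proof.
have [aS v0a] := component_at_mem v0.
rewrite prodrMn; congr (_ *+ _).
  rewrite big_split /= -expr_sum mulrAC; congr (_ * _).
  rewrite big_split /= -expr_sum -(big_st_type *%R); congr (_ ^+ _ * _).
  (* Truncated subtraction is additive here, as no composition has more parts than its component has
     vertices. *)
  rewrite sumnB; last exact: st_size_ccomp.
  rewrite sum_card_cvert -[in RHS]sum1_size (big_st_type addn); congr (_ - _)%N.
  by apply: eq_bigr => c _; rewrite sum1_size.
rewrite (bigD1 _ aS) /= v0a big1 ?muln1 // => c /andP[cS ca].
case: ifP => // v0c; case/eqP: ca.
by rewrite (component_atE cS v0c).
Qed.

End TripleWeight.

(** This is [finite_tutte] in [A] at the image [t *: 1] of [t]: the variables will be power series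
    while [t] is a scalar. *)
Lemma finite_tutte_alg (R : comNzRingType) (A : comAlgType R) (T : finType)
    (t0 : T) (x : T -> A) (t : R) (n : nat) (G : graph n) (v0 : 'I_n) :
  \sum_(kappa : {ffun 'I_n -> T})
    (1 + t) ^+ #|mono_edge_set G kappa| *:
      \prod_v x (kappa v) =
  \sum_(S | marked_triple G v0 S)
    (((-1) ^+ (n - size (st_type S)) * t ^+ st_edges S) *:
      \prod_(k <- st_type S) esymf x k) *+ cfirst (component_at S v0).
Proof.
have expA (c : R) k : (c ^+ k)%:A = c%:A ^+ k :> A by rewrite exprZn expr1n.
transitivity (\sum_(S | marked_triple G v0 S)
    \prod_(c in S) ctriple_weight x (t *: 1) v0 c); last first.
  apply: eq_bigr => S /andP[ST _]; rewrite (prod_ctriple_weight v0 ST).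
  congr (_ *+ _); rewrite -[RHS]mulr_algl; congr (_ * _).
  by rewrite -[RHS]/(in_alg A _) rmorphM !rmorphXn rmorphN1.
rewrite -(finite_tutte t0); apply: eq_bigr => kappa _.
by rewrite -[LHS]mulr_algl expA scalerDl scale1r.
Qed.

Local Notation "x * y" := (mmul x y) : monom_scope.
Local Notation "1" := mone : monom_scope.
Local Notation "'U_(' i )" := (ucm i) : monom_scope.

(** * Truncation of power series to finitely many variables *)

Section Truncation.
Context (R : comNzRingType) (N : nat).
Implicit Types (f g : fps nat R) (m : {cmonom nat}).

Definition low_monom m : bool := all (leq^~ N) (finsupp m).

Lemma low_monomM m m' : low_monom (m * m')%M = low_monom m && low_monom m'.
Proof.
rewrite /low_monom mdomD; apply/allP/andP => [low|[/allP lm /allP lm'] i].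
  by split; apply/allP => i im; apply: low; rewrite in_fsetU im ?orbT.
by rewrite in_fsetU => /orP[/lm|/lm'].
Qed.

(** The substitution of 0 for every variable of index above [N], read on coefficients. *)
Definition trunc f : fps nat R := Fps (fun m => if low_monom m then f m else 0).

Fact trunc_zmod_morphism : zmod_morphism trunc.
Proof.
move=> f g; apply/fpsP => m.
change ((if low_monom m then f m - g m else 0) =
  (if low_monom m then f m else 0) - (if low_monom m then g m else 0)).
by case: ifP; rewrite ?subr0.
Qed.

(** A product of monomials is low exactly when both factors are. *)
Fact trunc_monoid_morphism : monoid_morphism trunc.
Proof.
split=> [|f g]; apply/fpsP => m.
  change ((if low_monom m then (m == 1%M)%:R else 0) = (m == 1%M)%:R :> R).
  case: eqP => [->|_]; last by rewrite if_same.
  by rewrite /low_monom mdom1.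
change ((if low_monom m then fps_mul f g m else 0) = fps_mul (trunc f) (trunc g) m).
rewrite !fps_mulE; case: ifP => low.
  apply: eq_big_seq => p; rewrite mem_mfact => /eqP pm.
  by move: low; rewrite -pm low_monomM /= => /andP[-> ->].
rewrite big_seq big1 // => p; rewrite mem_mfact => /eqP pm.
move: low; rewrite -pm low_monomM /=.
by case: (low_monom p.1) => /= [->|]; rewrite ?mulr0 ?mul0r.
Qed.

Fact trunc_scalable : scalable trunc.
Proof.
move=> c f; apply/fpsP => m.
change ((if low_monom m then c * f m else 0) = c * (if low_monom m then f m else 0)).
by case: ifP; rewrite ?mulr0.
Qed.

HB.instance Definition _ :=
  GRing.isZmodMorphism.Build _ _ trunc trunc_zmod_morphism.
HB.instance Definition _ :=
  GRing.isMonoidMorphism.Build _ _ trunc trunc_monoid_morphism.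
HB.instance Definition _ := GRing.isScalable.Build _ _ _ _ trunc trunc_scalable.

Lemma fps_coef_sum (I : Type) (r : seq I) (P : pred I) (F : I -> fps nat R) m :
  (\sum_(i <- r | P i) F i) m = \sum_(i <- r | P i) F i m.
Proof. by elim/big_rec2: _ => // i y f _ <-. Qed.

(** The infinite family is cut down to the members listed by [h]; truncation kills all others. *)
Lemma trunc_fps_sum (T : choiceType) (A : set T) (F : T -> fps nat R)
    (J : finType) (P : pred J) (h : J -> T) :
  {in P &, injective h} -> (forall j, P j -> A (h j)) ->
  (forall i, A i -> i \notin [seq h j | j <- enum P] -> trunc (F i) = 0) ->
  trunc (fps_sum A F) = \sum_(j | P j) trunc (F (h j)).
Proof.
move=> hI hA F0; apply/fpsP => m; rewrite fps_coef_sum /=.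
case: ifP => low; last by rewrite big1.
rewrite (fsbigE [seq h j | j <- enum P]).
- rewrite big_seq_cond (eq_bigl (mem [seq h j | j <- enum P])) => [|i]; last first.
    apply: andb_idr => /mapP[j + ->].
    by rewrite mem_enum => Pj; apply/mem_set/hA.
  by rewrite -big_seq big_map big_enum.
- by rewrite map_inj_in_uniq ?enum_uniq // => i j; rewrite !mem_enum; exact: hI.
- by move=> _ /mapP[j + ->]; rewrite mem_enum; exact: hA.
- by move=> i Ai /(F0 i Ai)/fpsP/(_ m) /=; rewrite low.
Qed.

Lemma trunc_var_eq0 i : (N < i)%N -> trunc (fps_var R i) = 0.
Proof.
move=> Ni; apply/fpsP => m /=; case: ifP => // low.
case: eqP => // mE; move: low; rewrite mE /low_monom mdomU.
by move/allP/(_ i); rewrite in_fset1 eqxx leqNgt Ni => /(_ isT).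
Qed.

End Truncation.

(** A monomial involves finitely many variables, so it survives once [N] bounds their indices. *)
Lemma trunc_ext (R : comNzRingType) (f g : fps nat R) :
  (forall N, trunc N f = trunc N g) -> f = g.
Proof.
move=> fg; apply/fpsP => m; pose N := \max_(i <- finsupp m) i.
have /fpsP/(_ m) /= := fg N; rewrite (_ : low_monom N m) //.
by apply/allP => i im; rewrite /N (big_rem i) //= leq_max leqnn.
Qed.

(** Coefficients are in an arbitrary [R]; for [{poly int}] this is [elem_sym] by conversion. *)
Definition elem_sym_over (R : comNzRingType) (k : nat) : fps nat R :=
  fps_sum [set A : {fset nat} | #|` A| = k]%classic
    (fun A => \prod_(c <- A) fps_var R c).

Definition tutte_sym_over (R : comNzRingType) (t : R) n (G : graph n) : fps nat R :=
  fps_sum [set: {ffun 'I_n -> nat}]%classic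
    (fun kappa => (1 + t) ^+ mono_edges G kappa *:
                    \prod_(v < n) fps_var R (kappa v)).

(** * Truncated symmetric functions as finite sums *)

Section SymmetricTruncation.
Context (R : comNzRingType) (t : R) (N : nat).

Definition trunc_var (i : 'I_N.+1) : fps nat R := trunc N (fps_var R (i : nat)).

(** Index sets bounded by [N] are the subsets of ['I_N.+1]; any other set contributes a variable
    that truncation kills. *)
Lemma trunc_elem_sym k : trunc N (elem_sym_over R k) = esymf trunc_var k.
Proof.
pose h (B : {set 'I_N.+1}) := [fset nat_of_ord i | i in B]%fset.
have hP (B : {set 'I_N.+1}) (i : 'I_N.+1) : (nat_of_ord i \in h B) = (i \in B).
  by apply/imfsetP/idP => [[j jB /val_inj->]|iB] //; exists i.
have h_perm B : perm_eq (h B) [seq nat_of_ord i | i <- enum B].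
  apply: uniq_perm; rewrite ?fset_uniq ?(map_inj_uniq val_inj) ?enum_uniq //.
  move=> i; apply/imfsetP/mapP => -[j jB ->]; exists j => //.
    by rewrite mem_enum.
  by rewrite mem_enum in jB.
rewrite /elem_sym_over.
rewrite (trunc_fps_sum (P := fun B : {set 'I_N.+1} => #|B| == k) (h := h)).
- apply: eq_bigr => B _; rewrite (perm_big _ (h_perm B)) big_map big_enum /=.
  exact: rmorph_prod.
- by move=> B D _ _ BD; apply/setP => i; rewrite -!hP BD.
- move=> B /eqP <- /=; rewrite (perm_size (h_perm B)) size_map.
  by rewrite cardE.
- move=> A /= Ak Ah; have [/allP AN|/allPn[i iA Ni]] := boolP (all (leq^~ N) A).
    pose B := [set i : 'I_N.+1 | nat_of_ord i \in A].
    have hB : h B = A.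
      apply/fsetP => i; apply/imfsetP/idP => [[j + ->]|iA].
        by rewrite inE.
      have iN : (i < N.+1)%N by rewrite ltnS AN.
      by exists (inord i); rewrite /= ?inE inordK.
    case/mapP: Ah; exists B => //; rewrite mem_enum -topredE /=.
    by rewrite -Ak -hB (perm_size (h_perm B)) size_map -cardE.
  by rewrite (big_rem i) //= rmorphM /= trunc_var_eq0 ?mul0r // ltnNge.
Qed.

Lemma trunc_tutte_sym n (G : graph n) :
  trunc N (tutte_sym_over t G) =
  \sum_(kappa : {ffun 'I_n -> 'I_N.+1})
    (1 + t) ^+ #|mono_edge_set G kappa| *:
      \prod_v trunc_var (kappa v).
Proof.
pose h (kappa : {ffun 'I_n -> 'I_N.+1}) : {ffun 'I_n -> nat} :=
  [ffun v => nat_of_ord (kappa v)].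
have hE kappa v : h kappa v = kappa v by rewrite ffunE.
have monoE kappa : mono_edges G (h kappa) =
    #|mono_edge_set G kappa|.
  apply: eq_card => e; rewrite !inE; congr (_ && _).
  apply: eq_forallb => u; congr (_ ==> _).
  by apply: eq_forallb => v; rewrite !hE val_eqE.
rewrite /tutte_sym_over (trunc_fps_sum (P := predT) (h := h)) //.
- apply: eq_bigr => kappa _; rewrite linearZ rmorph_prod /=.
  rewrite monoE.
  apply: (congr1 (fun z => _ *: z)).
  by apply: eq_bigr => v _; rewrite hE.
- move=> a b _ _ /ffunP ab; apply/ffunP => v; apply/val_inj.
  by have := ab v; rewrite !hE.
- move=> kappa _ kh; have [/forallP kN|] := boolP [forall v, kappa v <= N]%N.
    case/mapP: kh; exists [ffun v => inord (kappa v)]; first by rewrite mem_enum.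
    by apply/ffunP => v; rewrite hE ffunE inordK // ltnS.
  rewrite negb_forall => /existsP[v]; rewrite -ltnNge => Nv.
  by rewrite linearZ (bigD1 v) //= rmorphM /= trunc_var_eq0 // mul0r scaler0.
Qed.

End SymmetricTruncation.

(** * Expansion over subgraph triples and the first column of the matrix *)

Lemma tutte_sym_triples (R : comNzRingType) (t : R) n (G : graph n) (v0 : 'I_n) :
  tutte_sym_over t G =
  \sum_(S | marked_triple G v0 S)
    (((-1) ^+ (n - size (st_type S)) * t ^+ st_edges S) *:
      \prod_(k <- st_type S) elem_sym_over R k) *+ cfirst (component_at S v0).
Proof.
(* For each [N] the claim becomes [finite_tutte_alg] with colours in ['I_N.+1]. *)
apply: trunc_ext => N; rewrite trunc_tutte_sym raddf_sum.
rewrite (finite_tutte_alg ord0 _ _ _ v0); apply: eq_bigr => S _.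
rewrite raddfMn /= linearZ rmorph_prod /=; congr (_ *: _ *+ _).
by apply: eq_bigr => k _; rewrite trunc_elem_sym.
Qed.

(* [n] will be [m + 0], which is not convertible to [m]. *)
Lemma tutte_sym_relabel (R : comNzRingType) (t : R) m n
    (G : graph m.+1) (H : graph n.+1) :
  n = m ->
  gedges H = [set [set inord (nat_of_ord v) | v in (e : {set 'I_m.+1})]
                | e in gedges G] ->
  tutte_sym_over t G = tutte_sym_over t H.
Proof.
move=> nm; rewrite nm in H *.
have idE (e : {set 'I_m.+1}) : [set inord (nat_of_ord v) | v in e] = e.
  by rewrite -[RHS]imset_id; apply: eq_imset => v; rewrite inord_val.
rewrite (eq_imset _ idE) imset_id => HG.
by rewrite /tutte_sym_over; congr fps_sum; apply/funext => kappa; rewrite /mono_edges HG.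
Qed.

Lemma ctriple_comp_neq0 n (G : graph n) (c : ctriple n) :
  is_component_triple G c -> ccomp c != [::] /\ all (leq 1) (ccomp c).
Proof.
move=> cT; have [u uc] := ctriple_vert_neq0 cT.
have /and5P[_ _ _ /andP[c0 /eqP sc] _] := cT; split=> //.
apply: contraTneq uc => c_nil; move: sc; rewrite c_nil /= => /esym/eqP.
by rewrite cards_eq0 => /eqP ->; rewrite inE.
Qed.

(** The path with one vertex is the glued vertex alone, which lies in its own component, and a last
    part is at least 1; the last two conditions of [in_ST] thus always hold. *)
Lemma in_ST0E m (G : graph m.+1) i (S : {set ctriple (m + 0).+1}) :
  in_ST G i S = marked_triple (graph_sum G (path_graph 1)) ord0 S &&
                (cfirst (component_at S ord0) == i).
Proof.
apply/and5P/andP => [[ST iE mk _ _]|[/andP[ST /forall_inP mk] iE]].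
  split=> //; apply/andP; split=> //; apply/forall_inP => c cS; apply/implyP => c0.
  by rewrite -(component_atE ST cS c0).
have [cS c0] := component_at_mem ST ord0.
split=> //; first exact: (implyP (mk _ cS)).
  apply/subsetP => v; rewrite inE => mv.
  suff -> : v = inord m by case: (component_at_mem ST (inord m)).
  apply/val_inj/eqP; rewrite /= inordK ?addn0 // eqn_leq mv andbT.
  by rewrite -ltnS -[X in (_ < X.+1)%N]addn0.
have [dS _] := component_at_mem ST (inord m).
have [d_nil /allP d0] := ctriple_comp_neq0 (st_triple ST dS).
rewrite /clast; apply: d0; case: (ccomp _) d_nil => //= a s _.
exact: mem_last.
Qed.

Lemma cfirst_component_at n (G : graph n) (S : {set ctriple n}) v :
  is_subgraph_triple G S ->
  (0 < cfirst (component_at S v) <= n)%N && (cfirst (component_at S v) \in st_type S).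
Proof.
move=> ST; have [cS vc] := component_at_mem ST v; set c := component_at S v in cS vc *.
have [c_nil /allP c0] := ctriple_comp_neq0 (st_triple ST cS).
have fc : cfirst c \in ccomp c.
  by rewrite /cfirst; case: (ccomp c) c_nil => //= a s _; rewrite mem_head.
rewrite c0 //=; apply/andP; split.
  by case/mapP: fc => k _ ->; rewrite -ltnS.
rewrite mem_sort; apply/flattenP; exists (ccomp c) => //.
by apply/mapP; exists c; rewrite ?mem_enum.
Qed.

Lemma sum_in_ST (R : comNzRingType) (t : R) m (G : graph m.+1) :
  \sum_(i < (m + 0).+1) (elem_sym_over R i.+1 *+ i.+1) *
    \sum_(S : {set ctriple (m + 0).+1} | in_ST G i.+1 S)
      ((-1) ^+ ((m + 0).+1 - size (st_type S)) * (-1) ^+ 0 *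
        t ^+ (st_edges S + 1 - 1)) *: \prod_(k <- st_rtype S) elem_sym_over R k =
  tutte_sym_over t G.
Proof.
(* Gluing the edgeless one-vertex path leaves [G] as it is, up to the vertex type. *)
rewrite (@tutte_sym_relabel R t _ _ G (graph_sum G (path_graph 1))) ?addn0 //;
  last first.
  rewrite /= /sum_edges (_ : gedges (path_graph 1) = set0) ?imset0 ?setU0 //.
  apply/setP => e; rewrite !inE; apply/existsP => -[u /existsP[v /andP[]]].
  by rewrite !ord1.
rewrite (tutte_sym_triples _ _ ord0).
(* Triples are grouped by the first part at vertex 1, shifted down by one because index [i] stands
   for the part [i.+1]; [inord] is exact as this part lies between 1 and the number of vertices. *)
rewrite [RHS](partition_big (fun S : {set ctriple (m + 0).+1} =>
  inord (cfirst (component_at S ord0)).-1 : 'I_(m + 0).+1) xpredT) //=.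
apply: eq_bigr => i _; rewrite mulr_sumr.
apply: eq_big => [S|S].
  rewrite in_ST0E; apply: andb_id2l => /andP[ST _].
  have /andP[/andP[f0 fn] _] := cfirst_component_at ord0 ST.
  rewrite -[RHS]val_eqE /= inordK; last by rewrite prednK.
  by case: (cfirst _) f0.
rewrite in_ST0E => /andP[/andP[ST _] /eqP fi].
have /andP[_ fS] := cfirst_component_at ord0 ST.
rewrite fi in fS; rewrite fi mulrnAl; congr (_ *+ _).
rewrite mulr1 addnK -scalerAr; apply: (congr1 (fun z => _ *: z)).
by rewrite /st_rtype fi (perm_big _ (perm_to_rem fS)) big_cons.
Qed.

Theorem proposition3p4 (m : nat) (G : graph m.+1) :
  tutte_sym G = inf_dot (inf_vecmx vec_v (tutte_mx G)) vec_w.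
Proof.
rewrite -[LHS]/(tutte_sym_over 'X G) -sum_in_ST.
(* [vec_w] is supported at index 0, so only the column of the one-vertex path remains. *)
rewrite /inf_dot (fsbigE [:: 0%N]) //; last first.
  by move=> j _; rewrite inE /vec_w => /negPf ->; rewrite mulr0.
rewrite [RHS]big_mkcond big_seq1 mem_set // mulr1.
(* By [tutte_mx_eq0] only the rows for first parts up to the number of vertices remain. *)
rewrite /inf_vecmx (fsbigE (iota 0 (m + 0).+1)) ?iota_uniq //; last first.
  move=> i _; rewrite mem_iota -leqNgt => mi.
  by rewrite tutte_mx_eq0 ?mulr0.
rewrite [RHS](eq_bigl xpredT) => [|i]; last by rewrite mem_set.
rewrite -[iota _ _]/(index_iota 0 (m + 0).+1) big_mkord.
by [].
Qed.
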